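(* Let $R$ be one of the column relations $\mathbb Y^2=\mathbf 1-\mathbb X^2$, $\mathbb Y^2=\mathbf 1+\mathbb X^2$, $\mathbb X\mathbb Y+\mathbb Y\mathbb X=\mathbf 0$. If a nc sequence $\beta\equiv\beta^{(4)}$ with a moment matrix $\mathcal M_2(\beta)$ of rank 6 satisfying $R$ admits a nc measure, then it admits a nc measure with all atoms of size at most 2.
   Context: Words are elements of the free monoid on noncommuting letters $X,Y$; $|w|$ is the length of $w$, $w^*$ its reverse, and $v,w$ are cyclically equivalent if $v$ is a cyclic permutation of $w$. A sequence $\beta\equiv\beta^{(4)}=(\beta_w)_{|w|\le4}$ is a family of real numbers with $\beta_v=\beta_w$ for cyclically equivalent $v,w$ and $\beta_w=\beta_{w^*}$. It is a nc sequence if $\beta_{X^2Y^2}\ne\beta_{XYXY}$. Its moment matrix $\mathcal M_2$ is the symmetric $7\times7$ matrix with rows and columns indexed by $1,X,Y,X^2,XY,YX,Y^2$ and $(U,V)$ entry $\beta_{U^*V}$; the column indexed by $w$ is denoted $w(\mathbb X,\mathbb Y)$, $\mathbf 1$ is the column indexed by the empty word, and ''satisfies a relation'' means that the corresponding linear relation between columns holds. A representing measure for $\beta$ consists of finitely many pairs $(A_i,B_i)$ (atoms) of real symmetric $t_i\times t_i$ matrices ($t_i$ is the size) and numbers $\lambda_i>0$ with $\sum_i\lambda_i=1$ and $\beta_w=\sum_i\lambda_i\mathrm{Tr}(w(A_i,B_i))$ for all $|w|\le4$, where $\mathrm{Tr}(A)=\frac1t\mathrm{tr}(A)$ for $A\in\mathbb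 R^{t\times t}$. It is of type $(m_1,\dots,m_r)$ if it has exactly $m_i$ atoms of size $i$ and $m_r\neq0$. It is minimal if no other representing measure has smaller type, where types are compared first by $r$, then by $m_r$, then $m_{r-1}$, ..., then $m_1$. $\beta$ admits a nc measure if it has a minimal representing measure of type $(m_1,\dots,m_r)$ with $r>1$. *)

(* Defs.v *)
From mathcomp Require Import all_boot all_order all_algebra.
From mathcomp Require Import reals.

Set Implicit Arguments.
Unset Strict Implicit.
Unset Printing Implicit Defensive.

Import Order.TTheory GRing.Theory Num.Theory.
Local Open Scope ring_scope.

Inductive letter := X | Y.
Notation word := (seq letter).

Definition cyclically_equivalent (v w : word) : Prop :=
  exists k, v = rot k w.

(* A truncated family (beta_w)_{|w| <= 4} is a total function on words of which
   only the values on words of length at most 4 are ever used. *)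
Definition is_sequence (R : realType) (beta : word -> R) : Prop :=
  (forall v w, (size v <= 4)%N -> (size w <= 4)%N ->
     cyclically_equivalent v w -> beta v = beta w) /\
  (forall w, (size w <= 4)%N -> beta w = beta (rev w)).

Definition is_nc_sequence (R : realType) (beta : word -> R) : Prop :=
  is_sequence beta /\ beta [:: X; X; Y; Y] <> beta [:: X; Y; X; Y].

Definition monomials : 7.-tuple word :=
  [tuple [::]; [:: X]; [:: Y]; [:: X; X]; [:: X; Y]; [:: Y; X]; [:: Y; Y]].

Definition moment_matrix (R : realType) (beta : word -> R) : 'M[R]_7 :=
  \matrix_(i, j) beta (rev (tnth monomials i) ++ tnth monomials j).

(* Meaningful for w in monomials: see col_moment_matrix. *)
Definition column (R : realType) (beta : word -> R) (w : word) : 'cV[R]_7 :=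
  \col_i beta (rev (tnth monomials i) ++ w).

Lemma col_moment_matrix (R : realType) (beta : word -> R) (j : 'I_7) :
  col j (moment_matrix beta) = column beta (tnth monomials j).
Proof. by apply/colP => i; rewrite !mxE. Qed.

Record weighted_atom (R : realType) := WeightedAtom {
  weight : R;
  atom_size : nat;
  atomX : 'M[R]_atom_size;
  atomY : 'M[R]_atom_size }.

Definition word_eval (R : realType) (t : nat) (A B : 'M[R]_t) (w : word) :
    'M[R]_t :=
  \prod_(l <- w) (if l is X then A else B).

Definition normalized_trace (R : realType) (t : nat) (A : 'M[R]_t) : R :=
  t%:R^-1 * \tr A.

Definition is_weighted_atom (R : realType) (a : weighted_atom R) : bool :=
  [&& 0 < weight a, (0 < atom_size a)%N,
      (atomX a)^T == atomX a & (atomY a)^T == atomY a].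

Definition representing_measure (R : realType) (beta : word -> R)
    (mu : seq (weighted_atom R)) : Prop :=
  [/\ all (@is_weighted_atom R) mu,
      \sum_(a <- mu) weight a = 1
    & forall w, (size w <= 4)%N ->
        beta w = \sum_(a <- mu)
          weight a * normalized_trace (word_eval (atomX a) (atomY a) w)].

(* The type (m_1, ..., m_r) is the sequence m of size r with m_i = m`_(i - 1). *)
Definition has_type (R : realType) (mu : seq (weighted_atom R)) (m : seq nat) :
    Prop :=
  last 0%N m <> 0%N /\
  forall i, count (fun a => atom_size a == i.+1) mu = nth 0%N m i.

Definition type_lt (m n : seq nat) : Prop :=
  (size m < size n)%N \/
  size m = size n /\
  exists i, [/\ (i < size m)%N, (nth 0 m i < nth 0 n i)%N
    & forall j, (i < j < size m)%N -> nth 0%N m j = nth 0%N n j].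

Definition minimal_measure (R : realType) (beta : word -> R)
    (mu : seq (weighted_atom R)) : Prop :=
  representing_measure beta mu /\
  forall nu m n, representing_measure beta nu ->
    has_type mu m -> has_type nu n -> ~ type_lt n m.

Definition nc_measure (R : realType) (beta : word -> R)
    (mu : seq (weighted_atom R)) : Prop :=
  minimal_measure beta mu /\ exists m, has_type mu m /\ (1 < size m)%N.

Definition admits_nc_measure (R : realType) (beta : word -> R) : Prop :=
  exists mu, nc_measure beta mu.

(* Main.v *)
(* The relation [R] holds at every atom [(A, B)] of a representing measure, so
   [A^2] commutes with [B] and [B^2] with [A]; hence [AB + BA] commutes with
   both. A common eigenvector [v] of [A], [B^2] and [AB + BA] spans together
   with [vB] a subspace invariant under [A] and [B], which splits off
   orthogonally. Iterating, every atom is an orthogonal sum of blocks of size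
   at most 2, so there is a representing measure with such atoms only, and a
   minimal measure cannot have larger ones. *)
Require Import Defs.
From mathcomp Require Import all_boot all_order all_algebra.
From mathcomp Require Import reals.
From mathcomp Require Import spectral complex ring lra.
Set Implicit Arguments.
Unset Strict Implicit.
Unset Printing Implicit Defensive.

Import Order.TTheory GRing.Theory Num.Theory.
Local Open Scope ring_scope.

(** * Positivity of the trace form and of the dot product of rows *)

Lemma mxtrace_trmulmx (R : comNzRingType) (m n : nat) (A : 'M[R]_(m, n)) :
  \tr (A^T *m A) = \sum_i \sum_j A j i ^+ 2.
Proof.
apply: eq_bigr => i _; rewrite mxE; apply: eq_bigr => j _.
by rewrite mxE expr2.
Qed.

Lemma mxtrace_trmulmx_ge0 (R : realDomainType) (m n : nat)
    (A : 'M[R]_(m, n)) : 0 <= \tr (A^T *m A).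
Proof.
by rewrite mxtrace_trmulmx; do 2!apply: sumr_ge0 => ? _; rewrite sqr_ge0.
Qed.

Lemma mxtrace_trmulmx_eq0 (R : realDomainType) (m n : nat)
    (A : 'M[R]_(m, n)) : (\tr (A^T *m A) == 0) = (A == 0).
Proof.
apply/idP/eqP => [|->]; last by rewrite mulmx0 mxtrace0.
rewrite mxtrace_trmulmx psumr_eq0 => [/allP h|? _]; last first.
  by apply: sumr_ge0 => ? _; rewrite sqr_ge0.
apply/matrixP => j i; rewrite mxE; move: (h i (mem_index_enum _)) => /=.
rewrite psumr_eq0 => [/allP /(_ j (mem_index_enum _)) /=|? _].
  by rewrite sqrf_eq0 => /eqP.
by rewrite sqr_ge0.
Qed.

Lemma rowdot_eq0 (R : realDomainType) (n : nat) (v : 'rV[R]_n) :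
  ((v *m v^T) 0 0 == 0) = (v == 0).
Proof.
rewrite -trace_mx11 -[v in v *m _]trmxK mxtrace_trmulmx_eq0.
by rewrite trmx_eq0.
Qed.

Lemma rowdot_ge0 (R : realDomainType) (n : nat) (v : 'rV[R]_n) :
  0 <= (v *m v^T) 0 0.
Proof. by rewrite -trace_mx11 -[v in v *m _]trmxK mxtrace_trmulmx_ge0. Qed.

(** * Common real eigenvectors of commuting symmetric matrices *)

(** Here [x] and [y] are the real and imaginary parts of a complex eigenvector for the eigenvalue
    [a + ib]. Comparing [(xA)y^T] with [x(yA)^T] gives [b(|x|^2 + |y|^2) = 0], so [b = 0]. *)
Lemma stablemx_row_real (R : rcfType) (n : nat) (A : 'M[R]_n) (x y : 'rV[R]_n)
    (a b : R) : A^T = A -> (x != 0) || (y != 0) ->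
  x *m A = a *: x - b *: y -> y *m A = b *: x + a *: y ->
  x *m A = a *: x /\ y *m A = a *: y.
Proof.
move=> symA nz hx hy.
have : (x *m A) *m y^T = x *m (y *m A)^T by rewrite trmx_mul symA mulmxA.
rewrite hx hy [in RHS]linearD /= ![in RHS]linearZ /=.
rewrite mulmxBl mulmxDr -!scalemxAl -!scalemxAr.
move=> /matrixP /(_ 0 0); rewrite !mxE => h.
have {h}: b * ((x *m x^T) 0 0 + (y *m y^T) 0 0) = 0.
  by rewrite !mxE; move: h; set p := \sum_i _; set q := \sum_i _;
     set r := \sum_i _ => h; lra.
move=> /eqP; rewrite mulf_eq0 paddr_eq0 ?rowdot_ge0 // !rowdot_eq0.
case/orP => [/eqP b0|]; last by case: (x == 0) nz => //= /negPf ->.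
by rewrite b0 !scale0r subr0 add0r.
Qed.

(** Over [R[i]] the commuting family has a common eigenvector. Its real and imaginary parts are each
    zero or an eigenvector of every matrix. *)
Lemma common_real_eigenvector (R : rcfType) (n : nat) (As : seq 'M[R]_n) :
  (0 < n)%N -> {in As, forall A, A^T = A} ->
  {in As &, forall A B, comm_mx A B} ->
  exists2 v : 'rV[R]_n, v != 0 & {in As, forall A, exists a, v *m A = a *: v}.
Proof.
move=> n0 symAs commAs; pose toC := real_complex R.
have [|z z0 /allP zP] :=
    @common_eigenvector R[i] n [seq map_mx toC A | A <- As] n0.
  move=> _ _ /mapP[A hA ->] /mapP[B hB ->].
  by rewrite /comm_mx -!map_mxM commAs.
pose x := map_mx (@complex.Re R) z; pose y := map_mx (@complex.Im R) z.
have xy : (x != 0) || (y != 0).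
  rewrite -negb_and; apply: contra z0 => /andP[/eqP hx /eqP hy].
  apply/eqP/rowP => j; rewrite mxE; apply/eqP; rewrite eq_complex.
  move/rowP/(_ j): hx; move/rowP/(_ j): hy; rewrite !mxE => -> ->.
  by rewrite !eqxx.
have key A : A \in As -> exists a, x *m A = a *: x /\ y *m A = a *: y.
  move=> hA; have /sub_rVP [l hl] := zP _ (map_f _ hA).
  exists (complex.Re l).
  apply: (@stablemx_row_real _ _ _ _ _ _ (complex.Im l)) => //.
  - exact: symAs.
  - apply/rowP => j; move/rowP/(_ j)/(congr1 (@complex.Re R)): hl.
    rewrite !mxE (raddf_sum (@complex.Re R : Rcomplex R -> R)) /=.
    case: (z 0 j) (l) => [zr zi] [lr li] /= <-.
    apply: eq_bigr => i _; rewrite !mxE.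
    by case: (z 0 i) => ? ? /=; rewrite mulr0 subr0.
  - apply/rowP => j; move/rowP/(_ j)/(congr1 (@complex.Im R)): hl.
    rewrite !mxE (raddf_sum (@complex.Im R : Rcomplex R -> R)) /=.
    case: (z 0 j) (l) => [zr zi] [lr li] /=; rewrite addrC => <-.
    apply: eq_bigr => i _; rewrite !mxE.
    by case: (z 0 i) => ? ? /=; rewrite mulr0 add0r.
(* The choice between the two parts does not depend on the matrix. *)
have [x0|x0] := eqVneq x 0.
  exists y; first by rewrite x0 eqxx in xy.
  by move=> A /key [a [_ ?]]; exists a.
by exists x => // A /key [a [? _]]; exists a.
Qed.

(** * Orthonormal bases and orthogonal complements *)

(** Gram-Schmidt by induction on the rank: normalize a nonzero row, project it out of [M], and
    recurse on the remainder, whose rank is one less. *)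
Lemma orthonormal_row_basis (R : rcfType) (m n k : nat) (M : 'M[R]_(m, n)) :
  \rank M = k -> exists U : 'M[R]_(k, n), U *m U^T = 1%:M /\ (U :=: M)%MS.
Proof.
elim: k m M => [|k IH] m M rM.
  exists 0; split; first by rewrite mul0mx; apply/matrixP => -[].
  by move/eqP: rM; rewrite mxrank_eq0 => /eqP ->; apply/eqmxP; rewrite !sub0mx.
have M0 : M != 0 by rewrite -mxrank_eq0 rM.
pose v := nz_row M; pose u := (Num.sqrt ((v *m v^T) 0 0))^-1 *: v.
have v0 : v != 0 by rewrite nz_row_eq0.
have vv : 0 < (v *m v^T) 0 0.
  by rewrite lt_neqAle rowdot_ge0 eq_sym rowdot_eq0 v0.
have uu : u *m u^T = 1%:M.
  rewrite /u linearZ /= -scalemxAl -scalemxAr scalerA.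
  have [d -> d0] : exists2 d, v *m v^T = d%:M & 0 < d.
    by exists ((v *m v^T) 0 0) => //; exact: mx11_scalar.
  rewrite mxE eqxx mulr1n -scalemx1 scalerA -invfM -expr2 sqr_sqrtr ?ltW //.
  by rewrite mulVf ?gt_eqF // scale1r.
have uM : (u <= M)%MS by rewrite scalemx_sub // nz_row_sub.
pose M' := M - M *m u^T *m u.
have M'u : M' *m u^T = 0 by rewrite mulmxBl -!mulmxA uu mulmx1 subrr.
have eM : (M :=: u + M')%MS.
  apply/eqmxP/andP; split.
    rewrite addsmxC -[X in (X <= _)%MS](subrK (M *m u^T *m u)).
    by rewrite addmx_sub_adds ?submxMl.
  by rewrite addsmx_sub uM addmx_sub ?eqmx_opp ?(submx_trans (submxMl _ _) uM).
(* A common vector is a multiple [a *: u] that is orthogonal to [u], so [a = 0]. *)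
have dM : (u :&: M' = 0)%MS.
  apply/eqP; rewrite -submx0; apply/rV_subP => w; rewrite sub_capmx.
  case/andP => /sub_rVP [a wu] /submxP [D wM].
  have : w *m u^T = 0 by rewrite wM -mulmxA M'u mulmx0.
  rewrite wu -scalemxAl uu => /matrixP /(_ 0 0); rewrite !mxE mulr1 => ->.
  by rewrite scale0r sub0mx.
have rM' : \rank M' = k.
  have := mxrank_disjoint_sum dM; rewrite -eM rM => h.
  have u0 : u != 0.
    apply/eqP => u0; move: uu; rewrite u0 mul0mx => /matrixP /(_ 0 0) /eqP.
    by rewrite !mxE eq_sym oner_eq0.
  by move: h; rewrite rank_rV u0 add1n => -[].
have [U' [UU' eU']] := IH _ _ rM'.
have U'u : U' *m u^T = 0.
  have /submxP[D ->] : (U' <= M')%MS by rewrite eU'.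
  by rewrite -mulmxA M'u mulmx0.
have orthU : col_mx u U' *m (col_mx u U')^T = 1%:M.
  rewrite tr_col_mx mul_col_row uu UU' U'u.
  have -> : u *m U'^T = 0 by rewrite -[u]trmxK -trmx_mul U'u trmx0.
  by rewrite -scalar_mx_block.
exists (col_mx u U'); split=> //; apply: eqmx_trans (eqmx_sym eM).
apply: (eqmx_trans (eqmx_sym (addsmxE u U'))); exact: adds_eqmx.
Qed.

(** The rows of [V] are an orthonormal basis of the kernel of [U^T]. By symmetry of [A], a row
    orthogonal to [U] stays so after applying [A], since [U] is stable. *)
Lemma orthonormal_complement (R : rcfType) (k n : nat) (U : 'M[R]_(k, n)) :
  U *m U^T = 1%:M ->
  exists V : 'M[R]_(n - \rank U, n),
    [/\ V *m V^T = 1%:M, V *m U^T = 0, U^T *m U + V^T *m V = 1%:M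
      & forall A : 'M[R]_n, A^T = A -> (U *m A <= U)%MS -> (V *m A <= V)%MS].
Proof.
move=> UU; have rK : \rank (kermx U^T) = (n - \rank U)%N.
  by rewrite mxrank_ker mxrank_tr.
have [V [VV eV]] := @orthonormal_row_basis _ _ _ _ _ rK.
have inV m (W : 'M_(m, n)) : W *m U^T = 0 -> (W <= V)%MS.
  by rewrite eV => /sub_kermxP.
have VU : V *m U^T = 0 by apply/sub_kermxP; rewrite -eV.
have UV : U *m V^T = 0 by rewrite -[LHS]trmxK trmx_mul trmxK VU trmx0.
exists V; split=> // [|A symA /submxP [D UA]].
  (* The defect [P] of the resolution of the identity has its rows in the span of [V], yet they are
     orthogonal to [V]; so it vanishes. *)
  apply/eqP; rewrite eq_sym -subr_eq0; apply/eqP; set P := _ - _.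
  have /submxP [D eD] : (P <= V)%MS.
    apply: inV; rewrite mulmxBl mulmxDl -!mulmxA UU VU mulmx0 addr0 mulmx1.
    by rewrite mul1mx subrr.
  have : P *m V^T = 0.
    by rewrite mulmxBl mulmxDl -!mulmxA UV VV mulmx0 add0r mulmx1 mul1mx subrr.
  by rewrite eD -mulmxA VV mulmx1 => ->; rewrite mul0mx.
apply: inV; rewrite -{1}symA -mulmxA -trmx_mul UA trmx_mul mulmxA VU.
by rewrite mul0mx.
Qed.

(** * Compressions to stable subspaces *)

(** When the rows of [U] are orthonormal and span a stable subspace, this is the matrix of [A] on
    that subspace in the basis [U]. *)
Definition compression (R : pzRingType) (k n : nat) (U : 'M[R]_(k, n))
  (A : 'M[R]_n) : 'M[R]_k := U *m A *m U^T.

Lemma compression_sym (R : comPzRingType) (k n : nat) (U : 'M[R]_(k, n))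
    (A : 'M[R]_n) : A^T = A -> (compression U A)^T = compression U A.
Proof. by move=> symA; rewrite /compression !trmx_mul trmxK symA mulmxA. Qed.

Lemma compression_stable (R : fieldType) (k n : nat) (U : 'M[R]_(k, n))
    (A : 'M[R]_n) : U *m U^T = 1%:M -> (U *m A <= U)%MS ->
  U *m A = compression U A *m U.
Proof.
move=> UU /submxP [D UA].
by rewrite /compression UA -!mulmxA [U *m (_ *m _)]mulmxA UU mul1mx.
Qed.

Lemma compressionM (R : fieldType) (k n : nat) (U : 'M[R]_(k, n))
    (A B : 'M[R]_n) : U *m U^T = 1%:M -> (U *m A <= U)%MS ->
  compression U (A *m B) = compression U A *m compression U B.
Proof.
move=> UU UA; rewrite {1}/compression mulmxA (compression_stable UU UA).
by rewrite /compression !mulmxA.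
Qed.

Lemma word_eval_cons (R : realType) (t : nat) (A B : 'M[R]_t) (l : letter) w :
  word_eval A B (l :: w) = (if l is X then A else B) *m word_eval A B w.
Proof. by rewrite /word_eval big_cons. Qed.

Lemma word_eval_compression (R : realType) (k n : nat) (U : 'M[R]_(k, n))
    (A B : 'M[R]_n) (w : word) : U *m U^T = 1%:M ->
  (U *m A <= U)%MS -> (U *m B <= U)%MS ->
  compression U (word_eval A B w) =
    word_eval (compression U A) (compression U B) w.
Proof.
move=> UU UA UB; elim: w => [|l w IH].
  by rewrite /word_eval !big_nil /compression mulmx1 UU.
by rewrite !word_eval_cons -IH; case: l; rewrite compressionM.
Qed.

(** Insert the resolution of the identity after [A] and use cyclicity of the trace. *)
Lemma mxtrace_compression (R : comPzRingType) (k l n : nat) (U : 'M[R]_(k, n))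
    (V : 'M[R]_(l, n)) (A : 'M[R]_n) : U^T *m U + V^T *m V = 1%:M ->
  \tr A = \tr (compression U A) + \tr (compression V A).
Proof.
move=> UV; rewrite -[A in LHS]mulmx1 -UV mulmxDr mxtraceD.
by congr (_ + _); rewrite mulmxA mxtrace_mulC mulmxA.
Qed.

(** * Splitting an atom into blocks of size at most 2 *)

(** The two rows of [M] may be dependent, which happens when [vB] is a multiple of [v]; hence the
    conclusion [M != 0] instead of a rank. *)
Lemma small_stable_subspace (R : rcfType) (t : nat) (A B : 'M[R]_t) :
  (0 < t)%N -> A^T = A -> B^T = B ->
  A *m A *m B = B *m (A *m A) -> B *m B *m A = A *m (B *m B) ->
  exists M : 'M[R]_(2, t),
    [/\ M != 0, (M *m A <= M)%MS & (M *m B <= M)%MS].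
Proof.
move=> t0 symA symB AAB BBA; pose C := A *m B + B *m A.
have AC : comm_mx A C.
  by rewrite /comm_mx /C mulmxDr mulmxDl !mulmxA AAB addrC -!mulmxA.
have BBC : comm_mx (B *m B) C.
  rewrite /comm_mx /C mulmxDr mulmxDl mulmxA BBA [B *m B *m (B *m A)]mulmxA.
  by rewrite -[B *m B *m B]mulmxA -!mulmxA [B *m (B *m A)]mulmxA BBA.
have BBA' : comm_mx (B *m B) A by [].
have [||v v0 vP] := @common_real_eigenvector _ _ [:: A; B *m B; C] t0.
- move=> D; rewrite !inE => /or3P[] /eqP -> //; first by rewrite trmx_mul symB.
  by rewrite /C linearD /= !trmx_mul symA symB addrC.
- by move=> D E; rewrite !inE => /or3P[] /eqP -> /or3P[] /eqP -> //;
     apply/comm_mx_sym.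
have [|a vA] := vP A; first by rewrite !inE eqxx.
have [|b vBB] := vP (B *m B); first by rewrite !inE eqxx orbT.
have [|c vC] := vP C; first by rewrite !inE eqxx !orbT.
pose M : 'M_(1 + 1, t) := col_mx v (v *m B).
have vM : (v <= M)%MS by rewrite -addsmxE addsmxSl.
have vBM : (v *m B <= M)%MS by rewrite -addsmxE addsmxSr.
have subM (D : 'M_t) : (v *m D <= M)%MS -> (v *m B *m D <= M)%MS ->
    (M *m D <= M)%MS.
  by move=> h1 h2; rewrite mul_col_mx -addsmxE addsmx_sub h1.
exists M; split.
- apply: contraNneq v0 => M0; move: vM.
  by rewrite (_ : M = 0) // => /submx0null ->.
- apply: subM; first by rewrite vA scalemx_sub.
  (* Expand [vC = c v] with [C = AB + BA] and [vA = a v]. *)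
  have -> : v *m B *m A = c *: v - a *: (v *m B).
    by rewrite -vC /C mulmxDr !mulmxA vA -scalemxAl addrC addKr.
  by rewrite addmx_sub ?eqmx_opp ?scalemx_sub.
- by apply: subM => //; rewrite -mulmxA vBB scalemx_sub.
Qed.

(** Strong induction on [t]: split off one block and recurse on its complement. The factor [c]
    stands for weight over size, because the plain trace, unlike the normalized one, is additive
    over blocks. *)
Lemma small_atoms_of_pair (R : realType) (t : nat) (A B : 'M[R]_t) (c : R) :
  0 < c -> A^T = A -> B^T = B ->
  A *m A *m B = B *m (A *m A) -> B *m B *m A = A *m (B *m B) ->
  exists s : seq (weighted_atom R),
    [/\ all (@is_weighted_atom R) s, all (fun a => (atom_size a <= 2)%N) s
      & forall w, c * \tr (word_eval A B w) =
          \sum_(a <- s)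
            weight a * normalized_trace (word_eval (atomX a) (atomY a) w)].
Proof.
move=> c0; have [n] := ubnP t; elim: n => // n IH in t A B *.
rewrite ltnS => tn symA symB AAB BBA.
(* The complement of the last block is empty and contributes no atom. *)
have [t0|t0] := posnP t.
  exists [::]; split=> // w; subst t.
  by rewrite big_nil /mxtrace big_ord0 mulr0.
have [M [M0 MA MB]] := small_stable_subspace t0 symA symB AAB BBA.
have [U [UU eU]] := @orthonormal_row_basis _ _ _ _ M erefl.
have [V [VV VU UV stabV]] := orthonormal_complement UU.
have UA : (U *m A <= U)%MS by rewrite eU (eqmxMr A eU).
have UB : (U *m B <= U)%MS by rewrite eU (eqmxMr B eU).
have VA := stabV _ symA UA; have VB := stabV _ symB UB.
(* Compression to a stable subspace is multiplicative, so the commutation relations pass to the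
   complement. *)
have VC (C D : 'M_t) : (V *m C <= V)%MS -> (V *m D <= V)%MS ->
    C *m C *m D = D *m (C *m C) ->
  compression V C *m compression V C *m compression V D =
  compression V D *m (compression V C *m compression V C).
  move=> VC VD CD; rewrite -!compressionM ?CD //.
  by rewrite mulmxA (submx_trans (submxMr _ VC)).
have rM : (0 < \rank M)%N by rewrite lt0n mxrank_eq0.
have [|||||s [s1 s2 s3]] := IH _ (compression V A) (compression V B).
- apply: leq_trans tn; rewrite eU ltn_subrL rM //.
- exact: compression_sym.
- exact: compression_sym.
- exact: VC.
- exact: VC.
(* The factor [\rank M] in the weight cancels the normalization of the trace on this block. *)
exists (WeightedAtom (c * (\rank M)%:R)
          (compression U A) (compression U B) :: s).
split=> [||w] /=.
- rewrite s1 andbT /is_weighted_atom /= rM !compression_sym // !eqxx !andbT.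
  by rewrite mulr_gt0 // ltr0n.
- by rewrite s2 rank_leq_row.
rewrite big_cons /= -s3 /normalized_trace.
rewrite (mxtrace_compression _ UV) !word_eval_compression // mulrDr.
by congr (_ + _); rewrite mulrA mulfK // pnatr_eq0 -lt0n.
Qed.

(** * From column relations to relations at the atoms *)

Lemma word_eval_rev_cat (R : realType) (t : nat) (A B : 'M[R]_t) (v w : word) :
  A^T = A -> B^T = B ->
  word_eval A B (rev v ++ w) = (word_eval A B v)^T *m word_eval A B w.
Proof.
move=> symA symB; rewrite /word_eval big_cat /=; congr (_ * _).
elim: v => [|l v IH]; first by rewrite !big_nil trmx1.
rewrite rev_cons -cats1 big_cat /= IH !big_cons big_nil mulr1 trmx_mul.
by case: l; rewrite ?symA ?symB.
Qed.

(** The value at an atom of the nc polynomial of degree at most 2 with coefficient vector [p]. *)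
Definition monomial_eval (R : realType) (p : 'cV[R]_7) (a : weighted_atom R) :
    'M[R]_(atom_size a) :=
  \sum_j p j 0 *: word_eval (atomX a) (atomY a) (tnth monomials j).

Lemma size_moment_word (i j : 'I_7) :
  (size (rev (tnth monomials i) ++ tnth monomials j) <= 4)%N.
Proof.
have small (k : 'I_7) : (size (tnth monomials k) <= 2)%N.
  by rewrite (tnth_nth [::]); case: k => [] [|[|[|[|[|[|[|]]]]]]].
by rewrite size_cat size_rev (leq_add (small i) (small j)).
Qed.

(** Both sides are the moment of the hermitian square [p^* p]; expand it bilinearly and exchange the
    sums. *)
Lemma moment_form (R : realType) (beta : word -> R)
    (mu : seq (weighted_atom R)) (p : 'cV[R]_7) :
  representing_measure beta mu ->
  \sum_i p i 0 * (moment_matrix beta *m p) i 0 =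
    \sum_(a <- mu) weight a *
      normalized_trace ((monomial_eval p a)^T *m monomial_eval p a).
Proof.
case=> atoms _ hbeta.
transitivity (\sum_i \sum_j \sum_(a <- mu) weight a * (atom_size a)%:R^-1 *
    (p i 0 * p j 0 * \tr (word_eval (atomX a) (atomY a)
       (rev (tnth monomials i) ++ tnth monomials j)))).
  apply: eq_bigr => i _; rewrite mxE big_distrr; apply: eq_bigr => j _ /=.
  rewrite mxE hbeta ?size_moment_word // mulrCA big_distrl /=.
  by apply: eq_bigr => a _; rewrite /normalized_trace; ring.
under eq_bigr do rewrite exchange_big /=.
rewrite exchange_big /=; elim: mu atoms {hbeta} => [|a mu IH] /=.
  by rewrite !big_nil.
case/andP => /and4P[_ _ /eqP symA /eqP symB] /IH {}IH.
rewrite !big_cons IH; congr (_ + _); rewrite /normalized_trace mulrA.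
rewrite /monomial_eval [(\sum_j _)^T]linear_sum /= mulmx_suml.
rewrite linear_sum /= big_distrr /=.
apply: eq_bigr => i _; rewrite mulmx_sumr linear_sum /= big_distrr /=.
apply: eq_bigr => j _; rewrite word_eval_rev_cat //.
by rewrite [(_ *: _)^T]linearZ -scalemxAl -scalemxAr /= !mxtraceZ !mulrA.
Qed.

(** The quadratic form of the moment matrix vanishes at [p]. It is a sum of nonnegative terms with
    positive weights, so each trace vanishes, and with it the value of [p] at each atom. *)
Lemma column_relation_atoms (R : realType) (beta : word -> R)
    (mu : seq (weighted_atom R)) (p : 'cV[R]_7) :
  representing_measure beta mu -> moment_matrix beta *m p = 0 ->
  all (fun a => monomial_eval p a == 0) mu.
Proof.
move=> hmu Mp; have [atoms _ _] := hmu; have := moment_form p hmu.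
rewrite Mp big1 => [|i _]; last by rewrite mxE mulr0.
move=> {hmu Mp} /esym; elim: mu atoms => //= a mu IH.
case/andP=> [/and4P[w0 s0 _ _] atoms].
have termP (b : weighted_atom R) : 0 < weight b ->
    0 <= weight b *
      normalized_trace ((monomial_eval p b)^T *m monomial_eval p b).
  move=> /ltW wb; rewrite mulr_ge0 // /normalized_trace mulr_ge0 //.
    by rewrite invr_ge0 ler0n.
  exact: mxtrace_trmulmx_ge0.
have sumP : 0 <= \sum_(b <- mu) weight b *
      normalized_trace ((monomial_eval p b)^T *m monomial_eval p b).
  elim: mu {IH} atoms => [|b mu IH] /=; first by rewrite big_nil.
  by case/andP => /andP[wb _] /IH hs; rewrite big_cons addr_ge0 ?termP.
rewrite big_cons => /eqP; rewrite paddr_eq0 ?termP // => /andP[ha /eqP hs].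
rewrite IH // andbT -mxtrace_trmulmx_eq0; move: ha.
by rewrite !mulf_eq0 invr_eq0 pnatr_eq0 (gt_eqF w0) (gtn_eqF s0).
Qed.

Lemma moment_matrix_mul (R : realType) (beta : word -> R) (p : 'cV[R]_7) :
  moment_matrix beta *m p = \sum_j p j 0 *: column beta (tnth monomials j).
Proof.
apply/colP => i; rewrite mxE summxE; apply: eq_bigr => j _.
by rewrite !mxE mulrC.
Qed.

(** Generic in [f], to expand both combinations of columns and evaluations at atoms. *)
Lemma sum_monomials (R : realType) (V : lmodType R) (f : word -> V)
    (c : seq R) :
  \sum_(j < 7) (\col_(k < 7) c`_k) j 0 *: f (tnth monomials j) =
    c`_0 *: f [::] + c`_1 *: f [:: X] + c`_2 *: f [:: Y] +
    c`_3 *: f [:: X; X] + c`_4 *: f [:: X; Y] + c`_5 *: f [:: Y; X] +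
    c`_6 *: f [:: Y; Y].
Proof.
by rewrite !big_ord_recl big_ord0 addr0 !mxE !(tnth_nth [::]) /= !addrA.
Qed.

Lemma word_eval2 (R : realType) (t : nat) (A B : 'M[R]_t) (k l : letter) :
  word_eval A B [:: k; l] =
    (if k is X then A else B) *m (if l is X then A else B).
Proof. by rewrite /word_eval !big_cons big_nil mulr1. Qed.

(** The common consequence of the three relations on which the splitting rests. *)
Definition squares_central (R : realType) (a : weighted_atom R) : bool :=
  let A := atomX a in let B := atomY a in
  (A *m A *m B == B *m (A *m A)) && (B *m B *m A == A *m (B *m B)).

(** At an atom, either each of [A^2] and [B^2] is an affine function of the other, or [A] and [B]
    anticommute and two sign changes cancel. *)
Lemma relation_squares_central (R : realType) (beta : word -> R)
    (mu : seq (weighted_atom R)) :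
  column beta [:: Y; Y] = column beta [::] - column beta [:: X; X] \/
  column beta [:: Y; Y] = column beta [::] + column beta [:: X; X] \/
  column beta [:: X; Y] + column beta [:: Y; X] = 0 ->
  representing_measure beta mu ->
  all (@squares_central R) mu.
Proof.
move=> hR hmu.
have [c [cM cA]] : exists c : seq R,
    moment_matrix beta *m (\col_k c`_k) = 0 /\
    forall a, monomial_eval (\col_k c`_k) a = 0 -> squares_central a.
  have central (t : nat) (A B : 'M[R]_t) e : B *m B = 1%:M + e *: (A *m A) ->
      B *m B *m A = A *m (B *m B).
    move=> ->; rewrite mulmxDl mulmxDr mul1mx mulmx1.
    by rewrite -scalemxAl -scalemxAr mulmxA.
  have swap (t : nat) (A B : 'M[R]_t) e : e * e = 1 ->
      B *m B = 1%:M + e *: (A *m A) -> A *m A = - e *: 1%:M + e *: (B *m B).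
    by move=> ee ->; rewrite scalerDr scalerA ee scale1r scaleNr addKr.
  (* The cases [e = -1] and [e = 1] are the first two relations. *)
  have quadric e : e * e = 1 ->
      column beta [:: Y; Y] = column beta [::] + e *: column beta [:: X; X] ->
    exists c : seq R,
    moment_matrix beta *m (\col_k c`_k) = 0 /\
    forall a, monomial_eval (\col_k c`_k) a = 0 -> squares_central a.
    (* Coefficients of [Y^2 - 1 - e X^2] in the order of [monomials]. *)
    move=> ee hY; exists [:: -1; 0; 0; - e; 0; 0; 1]; split.
      rewrite moment_matrix_mul sum_monomials /= !scale0r !addr0 hY.
      by rewrite scale1r scaleN1r scaleNr -opprD addNr.
    move=> a; rewrite /monomial_eval sum_monomials /= !scale0r !addr0 scale1r.
    rewrite !word_eval2 /word_eval big_nil scaleN1r scaleNr -opprD => /eqP.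
    rewrite addrC subr_eq0 => /eqP hB.
    apply/andP; split; apply/eqP; last exact: central hB.
    rewrite (swap _ _ _ _ ee hB).
    by rewrite mulmxDl mulmxDr -!scalemxAl -!scalemxAr mul1mx mulmx1 mulmxA.
  have anti (t : nat) (A B : 'M[R]_t) : A *m B = - (B *m A) ->
      A *m A *m B = B *m (A *m A).
    move=> AB; rewrite -mulmxA AB mulmxN [A *m (B *m A)]mulmxA AB.
    by rewrite mulNmx opprK mulmxA.
  case: hR => [hY|[hY|hXY]].
  - by apply: (quadric (-1)); rewrite ?mulrNN ?mulr1 // scaleN1r.
  - by apply: (quadric 1); rewrite ?mulr1 // scale1r.
  (* Coefficients of [XY + YX]. *)
  exists [:: 0; 0; 0; 0; 1; 1; 0]; split.
    rewrite moment_matrix_mul sum_monomials /=.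
    by rewrite !scale0r !add0r !addr0 !scale1r.
  move=> a; rewrite /monomial_eval sum_monomials /=.
  rewrite !scale0r !add0r !addr0 !scale1r.
  rewrite !word_eval2 => /eqP; rewrite addr_eq0 => /eqP AB.
  by apply/andP; split; apply/eqP; apply: anti; rewrite // AB opprK.
have := column_relation_atoms hmu cM; apply: sub_all => a /eqP.
exact: cA.
Qed.

(** * Measures with small atoms and their types *)

Lemma small_representing_measure (R : realType) (beta : word -> R)
    (mu : seq (weighted_atom R)) :
  representing_measure beta mu ->
  all (@squares_central R) mu ->
  exists nu, representing_measure beta nu /\
    all (fun a => (atom_size a <= 2)%N) nu.
Proof.
move=> [atoms mass hbeta] rel.
have [nu [nu1 nu2 nuE]] : exists nu : seq (weighted_atom R),
    [/\ all (@is_weighted_atom R) nu, all (fun a => (atom_size a <= 2)%N) nu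
      & forall w, \sum_(a <- mu)
            weight a * normalized_trace (word_eval (atomX a) (atomY a) w) =
          \sum_(a <- nu)
            weight a * normalized_trace (word_eval (atomX a) (atomY a) w)].
  elim: mu atoms rel {mass hbeta} => [|a mu IH] /=; first by exists [::].
  case/andP => /and4P[wa sa /eqP symA /eqP symB] atoms.
  case/andP => /andP[/eqP AAB /eqP BBA] /(IH atoms) [nu [nu1 nu2 nuE]].
  have c0 : 0 < weight a * (atom_size a)%:R^-1.
    by rewrite divr_gt0 // ltr0n.
  have [s [s1 s2 sE]] := small_atoms_of_pair c0 symA symB AAB BBA.
  exists (s ++ nu); split=> [||w]; rewrite ?all_cat ?s1 ?s2 //.
  by rewrite big_cons big_cat nuE -sE /normalized_trace mulrA.
(* The total mass is the moment of the empty word, so splitting the atoms preserves it. *)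
have mass_word (s : seq (weighted_atom R)) : all (@is_weighted_atom R) s ->
    \sum_(a <- s) weight a = \sum_(a <- s)
      weight a * normalized_trace (word_eval (atomX a) (atomY a) [::]).
  elim: s => [|a s IH] /=; first by rewrite !big_nil.
  case/andP => /and4P[_ sa _ _] /IH {}IH; rewrite !big_cons IH.
  rewrite /normalized_trace /word_eval big_nil mxtrace1 mulVf ?mulr1 //.
  by rewrite pnatr_eq0 -lt0n.
exists nu; split=> //; split=> //.
  by rewrite mass_word // -nuE -mass_word.
by move=> w hw; rewrite hbeta.
Qed.

(** The last entry of a type must be nonzero, so its length is 2 or 1 according to whether an atom
    of size 2 occurs. *)
Lemma small_measure_type (R : realType) (beta : word -> R)
    (mu : seq (weighted_atom R)) :
  representing_measure beta mu -> all (fun a => (atom_size a <= 2)%N) mu ->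
  exists m, has_type mu m /\ (size m <= 2)%N.
Proof.
move=> [atoms mass _] small; pose c i := count (fun a => atom_size a == i) mu.
have c0 i : (2 < i)%N -> c i = 0%N.
  move=> i2; apply/eqP; rewrite -leqn0 leqNgt -has_count; apply/negP => h.
  elim: mu small h {atoms mass c} => //= a mu IH.
  case/andP=> [a2 /IH {}IH] /orP[/eqP ai|//].
  by rewrite ai leqNgt i2 in a2.
have [c2|c2] := posnP (c 2%N).
  exists [:: c 1%N]; split=> //; split=> [/= c1|[|[|i]]] //; last exact: c0.
  (* Total mass 1 rules out the empty measure, so without atoms of size 2 there is one of size 1. *)
  case: mu atoms small mass @c c0 c2 c1 => [|a mu] /=.
    by rewrite big_nil => _ _ /eqP; rewrite eq_sym oner_eq0.
  case/andP => /and4P[_ sa _ _] _ /andP[a2 _] _ _.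
  by case: (atom_size a) sa a2 => [|[|[|]]].
exists [:: c 1%N; c 2%N]; split=> //; split=> [/= c2'|[|[|i]]] //; last first.
  by rewrite /= nth_nil; exact: c0.
by rewrite c2' in c2.
Qed.

(** Past the end of [m] the default value 0 of [nth] says that no atom has that size. *)
Lemma has_type_atom_size (R : realType) (mu : seq (weighted_atom R)) m :
  has_type mu m -> all (fun a => (atom_size a <= size m)%N) mu.
Proof.
move=> [_ hm].
have c0 i : (size m <= i)%N -> ~~ has (fun a => atom_size a == i.+1) mu.
  by move=> mi; rewrite has_count hm nth_default.
elim: mu c0 {hm} => //= a mu IH c0; rewrite IH ?andbT => [|i /c0]; last first.
  by case/norP.
rewrite leqNgt; apply/negP; case E : (atom_size a) => [//|i] /c0.
by rewrite E eqxx.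
Qed.

Theorem proposition7p1 (R : realType) (beta : word -> R)
    (hnc : is_nc_sequence beta)
    (hrank : \rank (moment_matrix beta) = 6%N)
    (hR : column beta [:: Y; Y] = column beta [::] - column beta [:: X; X] \/
          column beta [:: Y; Y] = column beta [::] + column beta [:: X; X] \/
          column beta [:: X; Y] + column beta [:: Y; X] = 0)
    (hmeas : admits_nc_measure beta) :
  exists mu : seq (weighted_atom R),
    nc_measure beta mu /\ all (fun a => (atom_size a <= 2)%N) mu.
Proof.
have [mu hmu] := hmeas; exists mu; split=> //.
have [[rep minimal] [m [typem _]]] := hmu.
have [nu [repnu small]] :=
  small_representing_measure rep (relation_squares_central hR rep).
have [n [typen n2]] := small_measure_type repnu small.
have m2 : (size m <= 2)%N.
  rewrite leqNgt; apply/negP => m3.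
  (* The length of the type is compared first, so [nu] would have a smaller type than the minimal
     [mu]. *)
  by case: (minimal _ _ _ repnu typem typen); left; apply: leq_ltn_trans m3.
apply: sub_all (has_type_atom_size typem) => a am; exact: leq_trans am m2.
Qed.
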